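(* Let $P=(X,\prec)$ be a finite poset with $|X|=n>2$ elements, and let $x,y\in\min(P)$ be distinct minimal elements of $P$. Then $$\frac{n}{n-1}\ \le\ \frac{e(P)\cdot e(P-x-y)}{e(P-x)\cdot e(P-y)}\ \le\ 2.$$
   Context: A linear extension of a poset $P=(X,\prec)$ with $|X|=n$ is a bijection $f:X\to\{1,\dots,n\}$ such that $u\prec v$ implies $f(u)<f(v)$. $e(P)$ denotes the number of linear extensions of $P$. $\min(P)$ is the set of minimal elements of $P$ (elements $u$ with no $v\prec u$). For $u\in X$, $P-u$ denotes the induced subposet on $X\setminus\{u\}$, and $P-x-y$ the induced subposet on $X\setminus\{x,y\}$. *)

(* Defs.v *)
From HB Require Import structures.
From mathcomp Require Import all_boot all_order all_algebra.

Set Implicit Arguments.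
Unset Strict Implicit.
Unset Printing Implicit Defensive.

Import Order.TTheory.
Local Open Scope order_scope.

(* The value set {1, ..., n} is represented by 'I_n = {0, ..., n - 1}; the     *)
(* order comparison on 'I_n is that of the underlying natural numbers.        *)
Definition linear_extension d (P : finPOrderType d) (f : {ffun P -> 'I_#|P|})
    : bool :=
  [&& injectiveb f, [forall i, i \in codom f]
    & [forall u : P, forall v : P, (u < v) ==> (f u < f v)%N]].

Lemma linear_extensionP d (P : finPOrderType d) (f : {ffun P -> 'I_#|P|}) :
  reflect (bijective f /\ forall u v : P, u < v -> (f u < f v)%N)
          (linear_extension f).
Proof.
apply: (iffP and3P) => [[/injectiveP f_inj _ /'forall_'forall_implyP f_mono]|].
  split=> //; apply: inj_card_bij => //; by rewrite card_ord.
case=> f_bij f_mono; split; first exact/injectiveP/bij_inj.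
- case: f_bij => g _ gK; apply/forallP => i; rewrite -[i]gK; exact: codom_f.
- exact/'forall_'forall_implyP.
Qed.

Definition num_linext d (P : finPOrderType d) : nat :=
  #|[set f : {ffun P -> 'I_#|P|} | linear_extension f]|.

Definition min_elems d (P : finPOrderType d) : {set P} :=
  [set u : P | ~~ [exists v : P, v < u]].

Definition subposet d (P : finPOrderType d) (A : {set P}) : Type :=
  {z : P | z \in A}.

HB.instance Definition _ d (P : finPOrderType d) (A : {set P}) :=
  SubFinite.on (subposet A).
HB.instance Definition _ d (P : finPOrderType d) (A : {set P}) :=
  [SubChoice_isSubPOrder of subposet A by <: with d].

Lemma lt_subposet d (P : finPOrderType d) (A : {set P}) (u v : subposet A) :
  (u < v) = (val u < val v).
Proof. by rewrite lt_val. Qed.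

(* Main.v *)
Require Import Defs.
From mathcomp Require Import all_boot all_order all_algebra.
From mathcomp Require Import lra zify.

Set Implicit Arguments.
Unset Strict Implicit.
Unset Printing Implicit Defensive.

Import Order.TTheory GRing.Theory Num.Theory.

(** Let vol(A) = e(A)/|A|! for a subset A of the poset. Removing the last (or
    the first) element of a linear extension gives
    |A| vol(A) = sum of vol(A - z) over the maximal (or minimal) z in A.
    Using this recursion two correlation inequalities are proved by a
    simultaneous induction on |A|:
    - vol(A - x) vol(A - y) <= vol(A) vol(A - x - y) for x, y minimal;
    - vol(A) vol(A - y - z) <= vol(A - y) vol(A - z) for y minimal, z maximal.
    The first is the lower bound. It also shows that e(A - x) / e(A - x - y)
    does not increase when a further minimal z is removed from A, which is what
    makes the upper bound pass through the recursion
    e(A) = e(A - x) + e(A - y) + sum of e(A - z) over the other minimal z. *)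

(** * Linear extensions of subsets, counted by removing the last or the first element *)

Section Counting.
Variable T : finType.
Implicit Types (r : rel T) (A : {set T}).

Definition strict_order r := irreflexive r /\ transitive r.

Definition converse r : rel T := fun u v => r v u.

Definition maximals r A := [set z in A | [forall w in A, ~~ r z w]].

(** Defined through the converse relation so that each fact about maximal elements dualizes by
    instantiation. *)
Definition minimals r A := maximals (converse r) A.

(** The counter [k] serves as fuel for the recursion on the set; [count_linext] starts it at the
    cardinality, so it runs out exactly at the empty set. *)
Fixpoint count_linext_rec r k A : nat :=
  if k is k'.+1 then \sum_(z in maximals r A) count_linext_rec r k' (A :\ z)
  else 1.

Definition count_linext r A : nat := count_linext_rec r #|A| A.

Lemma strict_converse r : strict_order r -> strict_order (converse r).
Proof.
case=> irr tr; split=> [u|v u w uv vw]; first exact: irr.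
exact: tr uv.
Qed.

Lemma maximalsP r A z :
  reflect (z \in A /\ forall w, w \in A -> ~~ r z w) (z \in maximals r A).
Proof.
rewrite inE; apply: (iffP andP) => -[zA zm]; split=> //; first by move/forall_inP: zm.
exact/forall_inP.
Qed.

Lemma minimalsP r A z :
  reflect (z \in A /\ forall w, w \in A -> ~~ r w z) (z \in minimals r A).
Proof. exact: maximalsP. Qed.

Lemma setD1C A x y : A :\ x :\ y = A :\ y :\ x.
Proof. by rewrite !setDDl setUC. Qed.

Lemma maximals_set0 r : maximals r set0 = set0.
Proof. by apply/setP=> z; rewrite !inE. Qed.

(** An element [z] with the most elements of [A] below it is maximal: anything above [z] has all of
    these below it, and [z] as well. *)
Lemma maximals_neq0 r A : strict_order r -> A != set0 ->
  exists z, z \in maximals r A.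
Proof.
case=> irr tr /set0Pn[x0 x0A].
case: (@arg_maxnP _ x0 [in A] (fun z => #|[set w in A | r w z]|) x0A) => z zA zmax.
exists z; apply/maximalsP; split=> // v vA; apply/negP=> rzv.
suff: #|[set w in A | r w z]| < #|[set w in A | r w v]|.
  by move=> lt_zv; have := leq_trans lt_zv (zmax v vA); rewrite ltnn.
apply: proper_card; apply/properP; split.
  by apply/subsetP=> w; rewrite !inE => /andP[-> /tr ->].
by exists z; rewrite !inE ?zA ?rzv ?irr ?andbF.
Qed.

Lemma maximals_sub r A z : z \in maximals r A -> z \in A.
Proof. by case/maximalsP. Qed.

Lemma maximals_setD1 r A z x : z \in maximals r A -> z != x ->
  z \in maximals r (A :\ x).
Proof.
case/maximalsP=> zA zm zx; apply/maximalsP; split; first by rewrite !inE zx.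
by move=> w; rewrite inE => /andP[_ /zm].
Qed.

Lemma minimals_setD1 r A z x : z \in minimals r A -> z != x ->
  z \in minimals r (A :\ x).
Proof. exact: maximals_setD1. Qed.

(** A minimal [x] lies above nothing, so it keeps no other element from being maximal. *)
Lemma maximals_setD1_minimal r A x : x \in minimals r A ->
  maximals r (A :\ x) = maximals r A :\ x.
Proof.
case/minimalsP=> xA xm; apply/setP=> z; rewrite in_setD1.
apply/maximalsP/andP=> [[]|[zx /maximalsP[zA zm]]].
  rewrite in_setD1 => /andP[zx zA] zm; split=> //.
  apply/maximalsP; split=> // w wA; case: (eqVneq w x) => [->|wx]; first exact: xm.
  by apply: zm; rewrite !inE wx.
split; first by rewrite !inE zx.
by move=> w; rewrite inE => /andP[_ /zm].
Qed.

Lemma minimals_setD1_maximal r A x : x \in maximals r A ->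
  minimals r (A :\ x) = minimals r A :\ x.
Proof. exact: (@maximals_setD1_minimal (converse r)). Qed.

Lemma card_setD1 A x : x \in A -> #|A :\ x| = #|A|.-1.
Proof. by move=> xA; rewrite [in RHS](cardsD1 x) xA. Qed.

Lemma count_linext0 r : count_linext r set0 = 1.
Proof. by rewrite /count_linext cards0. Qed.

Lemma count_linext_max r A : A != set0 ->
  count_linext r A = \sum_(z in maximals r A) count_linext r (A :\ z).
Proof.
rewrite -card_gt0 /count_linext; case E: #|A| => [//|k] _ /=.
by apply: eq_bigr => z /maximals_sub zA; rewrite card_setD1 ?E.
Qed.

(** Expanding each side one step further, in the opposite direction, turns both into the sum of
    [count_linext r (A :\ z :\ w)] over distinct [z] maximal and [w] minimal. *)
Lemma count_linext_converse r A : count_linext (converse r) A = count_linext r A.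
Proof.
move: {2}#|A| (leqnn #|A|) => k; elim: k A => [|k IH] A Ak.
  by move: Ak; rewrite leqn0 cards_eq0 => /eqP->; rewrite !count_linext0.
have [->|A0] := eqVneq A set0; first by rewrite !count_linext0.
have IHD z : z \in A -> count_linext (converse r) (A :\ z) = count_linext r (A :\ z).
  by move=> zA; apply: IH; rewrite card_setD1 //; lia.
rewrite [LHS]count_linext_max // [RHS]count_linext_max //.
(* The second expansion requires [A :\ z] to be nonempty, so singletons are settled directly; [r]
   may be reflexive at [a], in which case both counts are 0. *)
have [/eqP/cards1P[a ->]|A1] := eqVneq #|A| 1.
  have max1 s : \sum_(z in maximals s [set a]) count_linext s ([set a] :\ z)
       = (~~ s a a : nat).
    rewrite (eq_bigr (fun=> 1)) => [|z /maximals_sub]; last first.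
      by rewrite inE => /eqP->; rewrite setDv count_linext0.
    rewrite sum1_card; case: (boolP (s a a)) => saa /=.
      apply/eqP; rewrite cards_eq0; apply/eqP/setP=> z; rewrite !inE.
      apply/negP=> /andP[/eqP-> /forall_inP/(_ a)]; rewrite inE eqxx => /(_ isT).
      by rewrite saa.
    rewrite (_ : maximals s _ = [set a]) ?cards1 //; apply/setP=> z; rewrite !inE.
    apply: andb_idr => /eqP->; apply/forall_inP=> w; rewrite inE => /eqP->; exact: saa.
  by rewrite !max1.
have DA z : z \in A -> A :\ z != set0.
  by move=> zA; rewrite -card_gt0 card_setD1 //; move: A0 A1; rewrite -card_gt0; lia.
rewrite (eq_bigr (fun z => \sum_(w in maximals r A :\ z) count_linext r (A :\ z :\ w)));
  last first.
  move=> z zm; rewrite IHD ?(maximals_sub zm) // count_linext_max ?DA ?(maximals_sub zm) //.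
  by rewrite maximals_setD1_minimal.
rewrite [RHS](eq_bigr (fun z => \sum_(w in minimals r A :\ z) count_linext r (A :\ z :\ w)));
  last first.
  move=> z zm; rewrite -IHD ?(maximals_sub zm) // count_linext_max ?DA ?(maximals_sub zm) //.
  rewrite -/(minimals _ _) minimals_setD1_maximal //; apply: eq_bigr => w.
  rewrite in_setD1 => /andP[wz /maximals_sub wA]; apply: IH.
  have zA := maximals_sub zm.
  by rewrite (@card_setD1 (A :\ z)) ?card_setD1 ?in_setD1 ?wz //; lia.
rewrite (exchange_big_dep [in maximals r A]) /=; last first.
  by move=> z w _; rewrite inE => /andP[].
apply: eq_bigr => z zm; apply: eq_big => [w|w _]; last by rewrite setD1C.
by rewrite !in_setD1 zm andbT andbC eq_sym.
Qed.

Lemma count_linext_min r A : A != set0 ->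
  count_linext r A = \sum_(z in minimals r A) count_linext r (A :\ z).
Proof.
move=> A0; rewrite -count_linext_converse count_linext_max //.
by apply: eq_bigr => z _; rewrite count_linext_converse.
Qed.

Lemma count_linext_gt0 r A : strict_order r -> 0 < count_linext r A.
Proof.
move=> so; move: {2}#|A| (leqnn #|A|) => k; elim: k A => [|k IH] A Ak.
  by move: Ak; rewrite leqn0 cards_eq0 => /eqP->; rewrite count_linext0.
have [->|A0] := eqVneq A set0; first by rewrite count_linext0.
have [z zm] := maximals_neq0 so A0.
rewrite count_linext_max // (bigD1 z) //= ltn_addr // IH //.
by rewrite card_setD1 ?(maximals_sub zm) //; lia.
Qed.

(** * Volumes, and the effect on them of removing a minimal element *)

Local Open Scope ring_scope.

(* This is the volume of the order polytope of [A]. *)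
Definition volume r A : rat := (count_linext r A)%:R / (#|A|`!)%:R.

Lemma factr_neq0 k : (k`!)%:R != 0 :> rat.
Proof. by rewrite pnatr_eq0 -lt0n fact_gt0. Qed.

Lemma volumeE r A : (count_linext r A)%:R = (#|A|`!)%:R * volume r A.
Proof. by rewrite mulrC divfK ?factr_neq0. Qed.

Lemma volume_gt0 r A : strict_order r -> 0 < volume r A.
Proof. by move=> so; rewrite divr_gt0 ?ltr0n ?fact_gt0 ?count_linext_gt0. Qed.

Lemma volume_converse r A : volume (converse r) A = volume r A.
Proof. by rewrite /volume count_linext_converse. Qed.

Lemma volume_max r A :
  #|A|%:R * volume r A = \sum_(z in maximals r A) volume r (A :\ z).
Proof.
have [->|A0] := eqVneq A set0; first by rewrite maximals_set0 big_set0 cards0 mul0r.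
rewrite /volume count_linext_max // natr_sum.
have kA : #|A| = #|A|.-1.+1 by rewrite prednK // card_gt0.
rewrite [X in X`!]kA factS -kA natrM invfM mulrCA mulVKf; last first.
  by rewrite pnatr_eq0 kA.
rewrite mulr_suml; apply: eq_bigr => z /maximals_sub zA.
by rewrite card_setD1.
Qed.

Lemma volume_max_setD1 r A n x : x \in A -> #|A| = n.+1 ->
  n%:R * volume r (A :\ x) = \sum_(z in maximals r (A :\ x)) volume r (A :\ x :\ z).
Proof. by move=> xA kA; rewrite -volume_max card_setD1 // kA. Qed.

(** An element comparable to nothing can be inserted at any of |A| positions, so e(A) = |A| e(A -
    x). In the recursion, the term of [x] gives one copy of [volume r (A :\ x)] and the other terms
    give |A| - 1 copies. *)
Lemma volume_isolated r A x : strict_order r ->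
  x \in minimals r A -> x \in maximals r A -> volume r A = volume r (A :\ x).
Proof.
move=> so; move: {2}#|A| (leqnn #|A|) => k; elim: k A => [|k IH] A Ak xm xM.
  have := maximals_sub xM.
  by move: Ak; rewrite leqn0 cards_eq0 => /eqP->; rewrite inE.
have xA := maximals_sub xM.
have kA : #|A| = #|A|.-1.+1 by rewrite prednK //; apply/card_gt0P; exists x.
have n0 : #|A|%:R != 0 :> rat by rewrite pnatr_eq0 kA.
apply: (mulfI n0); rewrite volume_max (big_setD1 x) //=.
rewrite [in RHS]kA -addn1 natrD mulrDl mul1r addrC; congr (_ + _).
rewrite (volume_max_setD1 _ xA kA) maximals_setD1_minimal //.
apply: eq_bigr => z; rewrite in_setD1 => /andP[zx zM]; rewrite setD1C; apply: IH.
- by rewrite card_setD1 ?(maximals_sub zM) //; lia.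
- by apply: minimals_setD1; rewrite // eq_sym.
- by apply: maximals_setD1; rewrite // eq_sym.
Qed.

Lemma maximals_setD1_notin r A x : x \in minimals r A -> x \notin maximals r A ->
  maximals r (A :\ x) = maximals r A.
Proof.
move=> xm xM; rewrite maximals_setD1_minimal //; apply/setP=> z; rewrite in_setD1.
by apply: andb_idl; apply: contraTneq => ->.
Qed.

(** If [x] is not maximal, [A] and [A :\ x] have the same maximal elements, and comparing the
    recursions termwise gives |A| vol(A) <= (|A| - 1) vol(A - x). *)
Lemma volume_le_minimal r A x : strict_order r ->
  x \in minimals r A -> volume r A <= volume r (A :\ x).
Proof.
move=> so; move: {2}#|A| (leqnn #|A|) => k; elim: k A => [|k IH] A Ak xm.
  have := maximals_sub xm.
  by move: Ak; rewrite leqn0 cards_eq0 => /eqP->; rewrite inE.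
have [xM|xM] := boolP (x \in maximals r A); first by rewrite -volume_isolated.
have xA := maximals_sub xm.
have kA : #|A| = #|A|.-1.+1 by rewrite prednK //; apply/card_gt0P; exists x.
have n0 : 0 < #|A|%:R :> rat by rewrite ltr0n kA.
rewrite -(ler_pM2l n0) volume_max.
apply: (@le_trans _ _ (#|A|.-1%:R * volume r (A :\ x))); last first.
  by rewrite ler_wpM2r ?ler_nat ?leq_pred // ltW ?volume_gt0.
rewrite (volume_max_setD1 _ xA kA) maximals_setD1_notin //.
apply: ler_sum => z zM; rewrite setD1C; apply: IH.
  by rewrite card_setD1 ?(maximals_sub zM) //; lia.
by apply: minimals_setD1; rewrite //; apply: contraNneq xM => ->.
Qed.

(** * The two correlation inequalities *)

Definition min_min_correlation n := forall r A x y, strict_order r ->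
  (#|A| <= n)%N -> x \in minimals r A -> y \in minimals r A -> x != y ->
  volume r (A :\ x) * volume r (A :\ y) <= volume r A * volume r (A :\ x :\ y).

Definition min_max_correlation n := forall r A y z, strict_order r ->
  (#|A| <= n)%N -> y \in minimals r A -> z \in maximals r A -> y != z ->
  volume r A * volume r (A :\ y :\ z) <= volume r (A :\ y) * volume r (A :\ z).

(* With D, A', B, C the volumes of A, A - x, A - y, A - x - y, and d, a, b, c *)
(* those with a further maximal z removed, the induction hypotheses give      *)
(* ab <= dc and (Ca - A'c)(Cb - Bc) >= 0, hence A'Cb + BCa <= C^2 d + A'Bc;   *)
(* the sum over z is the claim multiplied by |A| C.                           *)
Lemma min_min_correlationS n :
  min_min_correlation n -> min_max_correlation n -> min_min_correlation n.+1.
Proof.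
move=> IH1 IH2 r A x y so An xm ym xy.
have yx : y != x by rewrite eq_sym.
have [xM|xM] := boolP (x \in maximals r A).
  rewrite [volume r A](volume_isolated so xm xM).
  rewrite [volume r (A :\ y)](@volume_isolated r _ x) //.
  - by rewrite setD1C.
  - exact: minimals_setD1.
  - exact: maximals_setD1.
have [yM|yM] := boolP (y \in maximals r A).
  rewrite [volume r A](volume_isolated so ym yM).
  rewrite [volume r (A :\ x)](@volume_isolated r _ y) //.
  - by rewrite mulrC.
  - exact: minimals_setD1.
  - exact: maximals_setD1.
have xA := maximals_sub xm; have yA := maximals_sub ym.
have yAx : y \in A :\ x by rewrite !inE yx.
have yMx : y \notin maximals r (A :\ x) by rewrite maximals_setD1_notin.
have ymx : y \in minimals r (A :\ x) by apply: minimals_setD1.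
have xmy : x \in minimals r (A :\ y) by apply: minimals_setD1.
have [m kA] : exists m, #|A| = m.+2.
  have : (0 < #|A :\ x|)%N by apply/card_gt0P; exists y.
  by rewrite card_setD1 //; case: #|A| => [|[|m]] // _; exists m.
have kAx : #|A :\ x| = m.+1 by rewrite card_setD1 // kA.
have HD := volume_max r A.
have HA := volume_max_setD1 r xA kA.
have HB := volume_max_setD1 r yA kA.
have HC := volume_max_setD1 r yAx kAx.
(* With neither [x] nor [y] maximal, the four recursions become sums over the same set
   [maximals r A]. *)
rewrite (@maximals_setD1_notin r _ y) // in HC.
rewrite !maximals_setD1_notin // in HA HB HC.
rewrite kA in HD.
have C0 := volume_gt0 (A :\ x :\ y) so.
set D := volume r A in HD *; set B := volume r (A :\ y) in HB *.
set C := volume r (A :\ x :\ y) in HC C0 *; set A' := volume r (A :\ x) in HA *.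
have key : \sum_(z in maximals r A)
   (A' * C * volume r (A :\ y :\ z) + B * C * volume r (A :\ x :\ z))
   <= \sum_(z in maximals r A)
   (C ^+ 2 * volume r (A :\ z) + A' * B * volume r (A :\ x :\ y :\ z)).
  apply: ler_sum => z zM; have zA := maximals_sub zM.
  have xz : x != z by apply: contraNneq xM => ->.
  have yz : y != z by apply: contraNneq yM => ->.
  have c0 := volume_gt0 (A :\ x :\ y :\ z) so.
  have zx : z != x by rewrite eq_sym.
  have zy : z != y by rewrite eq_sym.
  have An1 u : u \in A -> (#|A :\ u| <= n)%N.
    by move=> uA; rewrite card_setD1 ?kA // -ltnS -kA.
  have h1 := IH1 r (A :\ z) x y so (An1 z zA)
    (minimals_setD1 xm xz) (minimals_setD1 ym yz) xy.
  have h2 := IH2 r (A :\ x) y z so (An1 x xA) ymx (maximals_setD1 zM zx) yz.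
  have h3 := IH2 r (A :\ y) x z so (An1 y yA) xmy (maximals_setD1 zM zy) xz.
  move: h1 h2 h3 c0.
  rewrite (setD1C A z x) (setD1C A z y) (setD1C (A :\ x) z y) (setD1C A y x).
  rewrite -/A' -/B -/C.
  set d := volume r (A :\ z); set a := volume r (A :\ x :\ z).
  set b := volume r (A :\ y :\ z); set c := volume r (A :\ x :\ y :\ z).
  move=> h1 h2 h3 c0.
  rewrite -(ler_pM2r c0).
  have p1 : 0 <= (C * a - A' * c) * (C * b - B * c) by rewrite mulr_ge0 ?subr_ge0.
  have p2 : 0 <= C ^+ 2 * (d * c - a * b) by rewrite mulr_ge0 ?subr_ge0 ?sqr_ge0.
  lra.
(* The product [A' * B * C] gets the coefficient 2(m+1) - m = m+2, which is also that of
   [C ^+ 2 * D]. *)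
rewrite !big_split /= -!mulr_sumr -HD -HA -HB -HC in key.
rewrite -(ler_pM2r C0) -(@ler_pM2l _ m.+2%:R) ?ltr0n //.
move: key; rewrite -addn2 -[in m.+1%:R]addn1 !natrD; lra.
Qed.

(* As above, with w maximal, w != z, in the role of z. Two maximal elements   *)
(* z, w of A - y occur, so the min-min hypothesis is used for the converse    *)
(* order. The elements that become maximal only once z is removed contribute  *)
(* the separate inequality [key2].                                            *)
Lemma min_max_correlationS n :
  min_min_correlation n -> min_max_correlation n -> min_max_correlation n.+1.
Proof.
move=> IH1 IH2 r A y z so An ym zM yz.
have zy : z != y by rewrite eq_sym.
have ymz : y \in minimals r (A :\ z) by apply: minimals_setD1.
have zMy : z \in maximals r (A :\ y) by apply: maximals_setD1.
have [yM|yM] := boolP (y \in maximals r A).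
  rewrite [volume r A](volume_isolated so ym yM).
  rewrite [volume r (A :\ z)](@volume_isolated r _ y) //; last exact: maximals_setD1.
  by rewrite setD1C.
(* If [y] becomes isolated once [z] is removed, vol(A - z) = vol(A - y - z) cancels and vol(A) <=
   vol(A - y) remains. *)
have [yMz|yMz] := boolP (y \in maximals r (A :\ z)).
  rewrite [volume r (A :\ z)](@volume_isolated r _ y) // setD1C.
  by rewrite ler_wpM2r ?(ltW (volume_gt0 _ _)) ?volume_le_minimal.
have yA := maximals_sub ym; have zA := maximals_sub zM.
have yAz : y \in A :\ z by rewrite !inE yz.
have [m kA] : exists m, #|A| = m.+2.
  have : (0 < #|A :\ z|)%N by apply/card_gt0P; exists y.
  by rewrite card_setD1 //; case: #|A| => [|[|m]] // _; exists m.
have kAz : #|A :\ z| = m.+1 by rewrite card_setD1 // kA.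
have HD := volume_max r A.
have HA := volume_max_setD1 r yA kA.
have HB := volume_max_setD1 r zA kA.
have HC := volume_max_setD1 r yAz kAz.
rewrite (@maximals_setD1_notin r _ y) // in HC.
rewrite maximals_setD1_notin // in HA.
rewrite kA in HD.
have C0 := volume_gt0 (A :\ z :\ y) so.
have A0 := volume_gt0 (A :\ y) so.
rewrite (setD1C A y z).
rewrite (big_setD1 z) //= in HD; rewrite (big_setD1 z) //= (setD1C A y z) in HA.
(* The maximal elements of [A :\ z] are those of [A] other than [z], together with the elements that
   had only [z] above them. *)
have subM : maximals r A :\ z \subset maximals r (A :\ z).
  by apply/subsetP=> w; rewrite in_setD1 => /andP[wz wM]; apply: maximals_setD1.
rewrite (big_setID (maximals r A :\ z)) /= (setIidPr subM) in HB.
rewrite (big_setID (maximals r A :\ z)) /= (setIidPr subM) in HC.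
set D := volume r A in HD *; set B := volume r (A :\ z) in HB HD *.
set C := volume r (A :\ z :\ y) in HA HC C0 *; set A' := volume r (A :\ y) in HA A0 *.
have IH2z w : w \in maximals r (A :\ z) ->
    B * volume r (A :\ z :\ y :\ w) <= C * volume r (A :\ z :\ w).
  move=> wM; apply: IH2 => //; first by rewrite kAz -ltnS -kA.
  by apply: contraNneq yMz => ->.
have key : \sum_(w in maximals r A :\ z)
   (C ^+ 2 * volume r (A :\ w) + A' * B * volume r (A :\ z :\ y :\ w))
   <= \sum_(w in maximals r A :\ z)
   (A' * C * volume r (A :\ z :\ w) + B * C * volume r (A :\ y :\ w)).
  apply: ler_sum => w wMz; have h3 := IH2z w (subsetP subM w wMz).
  move: wMz; rewrite in_setD1 => /andP[wz wM]; have wA := maximals_sub wM.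
  have yw : y != w by apply: contraNneq yM => ->.
  have wy : w != y by rewrite eq_sym.
  have zw : z != w by rewrite eq_sym.
  have c0 := volume_gt0 (A :\ z :\ y :\ w) so.
  have An1 u : u \in A -> (#|A :\ u| <= n)%N.
    by move=> uA; rewrite card_setD1 ?kA // -ltnS -kA.
  have h1 := IH2 r (A :\ w) y z so (An1 w wA)
    (minimals_setD1 ym yw) (maximals_setD1 zM zw) yz.
  have h2 := IH1 (converse r) (A :\ y) z w (strict_converse so) (An1 y yA)
    zMy (maximals_setD1 wM wy) zw.
  rewrite !(volume_converse r) in h2.
  move: h1 h2 h3 c0.
  rewrite (setD1C A w y) (setD1C A w z) (setD1C (A :\ y) w z) (setD1C A y z).
  rewrite -/A' -/B -/C.
  set d := volume r (A :\ w); set a := volume r (A :\ y :\ w).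
  set b := volume r (A :\ z :\ w); set c := volume r (A :\ z :\ y :\ w).
  move=> h1 h2 h3 c0.
  rewrite -(ler_pM2r c0).
  have p1 : 0 <= (A' * c - C * a) * (C * b - B * c) by rewrite mulr_ge0 ?subr_ge0.
  have p2 : 0 <= C ^+ 2 * (a * b - d * c) by rewrite mulr_ge0 ?subr_ge0 ?sqr_ge0.
  lra.
have key2 : A' * (\sum_(w in maximals r (A :\ z) :\: (maximals r A :\ z))
      B * volume r (A :\ z :\ y :\ w))
   <= A' * (\sum_(w in maximals r (A :\ z) :\: (maximals r A :\ z))
      C * volume r (A :\ z :\ w)).
  rewrite (ler_pM2l A0); apply: ler_sum => w; rewrite inE => /andP[_]; exact: IH2z.
rewrite !big_split /= -!mulr_sumr in key key2.
rewrite -(ler_pM2r C0) -(@ler_pM2l _ m.+2%:R) ?ltr0n //.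
move: HA HB HC HD key key2; rewrite -[in m.+2%:R]addn2 -[in m.+1%:R]addn1 !natrD.
set M := maximals r A :\ z; set N := maximals r (A :\ z) :\: M.
set sd := \sum_(w in M) volume r (A :\ w).
set sa := \sum_(w in M) volume r (A :\ y :\ w).
set sb := \sum_(w in M) volume r (A :\ z :\ w).
set sc := \sum_(w in M) volume r (A :\ z :\ y :\ w).
set tb := \sum_(w in N) volume r (A :\ z :\ w).
set tc := \sum_(w in N) volume r (A :\ z :\ y :\ w).
move: sd sa sb sc tb tc => sd sa sb sc tb tc.
move=> HA HB HC HD.
(* After this elimination the terms [B * C ^+ 2], due to splitting off [z], cancel in [key]; the
   leftover [tb] and [tc] are controlled by [key2]. *)
have -> : sd = (m%:R + 2) * D - B by lra.
have -> : sa = (m%:R + 1) * A' - C by lra.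
have -> : sb = (m%:R + 1) * B - tb by lra.
have -> : sc = m%:R * C - tc by lra.
lra.
Qed.

Lemma correlation n : min_min_correlation n /\ min_max_correlation n.
Proof.
elim: n => [|n [IH1 IH2]]; last first.
  by split; [apply: min_min_correlationS | apply: min_max_correlationS].
split=> r A x y _; rewrite leqn0 cards_eq0 => /eqP->.
  by move/maximals_sub; rewrite inE.
by move/maximals_sub; rewrite inE.
Qed.

(** * The two bounds for the counts *)

Lemma count_linext_lower r A x y : strict_order r ->
  x \in minimals r A -> y \in minimals r A -> x != y ->
  (#|A| * (count_linext r (A :\ x) * count_linext r (A :\ y))
   <= #|A|.-1 * (count_linext r A * count_linext r (A :\ x :\ y)))%N.
Proof.
move=> so xm ym xy.
have xA := maximals_sub xm; have yA := maximals_sub ym.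
have yAx : y \in A :\ x by rewrite !inE eq_sym xy.
have [m kA] : exists m, #|A| = m.+2.
  have : (0 < #|A :\ x|)%N by apply/card_gt0P; exists y.
  by rewrite card_setD1 //; case: #|A| => [|[|m]] // _; exists m.
rewrite -(@ler_nat rat) !natrM !volumeE !card_setD1 // kA /= !factS !natrM.
have h := (correlation #|A|).1 r A x y so (leqnn _) xm ym xy.
(* With n = m+2 this is the factorial weight of both sides: n (n-1)!^2 = (n-1) n! (n-2)!. *)
have c0 : 0 <= m.+2%:R * m.+1%:R * m.+1%:R * (m`!)%:R ^+ 2 :> rat.
  by rewrite !mulr_ge0 ?ler0n.
by have := ler_wpM2l c0 h; lra.
Qed.

Lemma count_linext_supermodular r A x y : strict_order r ->
  x \in minimals r A -> y \in minimals r A -> x != y ->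
  (count_linext r (A :\ x) * count_linext r (A :\ y)
   <= count_linext r A * count_linext r (A :\ x :\ y))%N.
Proof.
move=> so xm ym xy; have h := count_linext_lower so xm ym xy.
have k0 : (0 < #|A|)%N by apply/card_gt0P; exists x; apply: maximals_sub xm.
rewrite -(leq_pmul2l k0); apply: leq_trans h _.
by rewrite leq_mul2r leq_pred orbT.
Qed.

(** Each term e(A - z) e(A - x - y) is at most e(A - x) e(A - y - z) + e(A - y) e(A - x - z). Summed
    over [z] and joined with the terms of [x] and [y], these fit into the expansions of e(A - y) and
    e(A - x), each multiplied by the other count; hence the factor 2. *)
Lemma count_linext_upper r A x y : strict_order r ->
  x \in minimals r A -> y \in minimals r A -> x != y ->
  (count_linext r A * count_linext r (A :\ x :\ y)
   <= 2 * (count_linext r (A :\ x) * count_linext r (A :\ y)))%N.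
Proof.
move=> so; move: {2}#|A| (leqnn #|A|) => k; elim: k A => [|k IH] A Ak xm ym xy.
  have := maximals_sub xm.
  by move: Ak; rewrite leqn0 cards_eq0 => /eqP->; rewrite inE.
have yx : y != x by rewrite eq_sym.
have xA := maximals_sub xm; have yA := maximals_sub ym.
have ymx : y \in minimals r (A :\ x) by apply: minimals_setD1.
have xmy : x \in minimals r (A :\ y) by apply: minimals_setD1.
have neq0 (B : {set T}) u : u \in B -> B != set0 by move=> uB; apply/set0Pn; exists u.
pose M := minimals r A :\ x :\ y.
(* Only an inequality: removing [x] or [y] from [A] may create minimal elements outside [M]. *)
have split_le (B : {set T}) u : u \in minimals r B -> u \notin M ->
    {subset M <= minimals r B} ->
    (count_linext r (B :\ u) + \sum_(z in M) count_linext r (B :\ z) <= count_linext r B)%N.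
  move=> uB uM sub; rewrite [leqRHS]count_linext_min ?(neq0 B u) ?(maximals_sub uB) //.
  rewrite [leqRHS](big_setD1 u) //= leq_add2l [leqRHS](big_setID M) /= (setIidPr _) ?leq_addr //.
  by apply/subsetP=> z zM; rewrite in_setD1 sub // andbT; apply: contraNneq uM => <-.
have MP z : z \in M -> [/\ z != x, z != y & z \in minimals r A].
  by rewrite /M !in_setD1 => /and3P[].
have hA : (count_linext r (A :\ x :\ y) + \sum_(z in M) count_linext r (A :\ x :\ z)
    <= count_linext r (A :\ x))%N.
  apply: split_le => //; first by rewrite /M !inE eqxx.
  by move=> z /MP[zx zy zm]; apply: minimals_setD1.
have hB : (count_linext r (A :\ x :\ y) + \sum_(z in M) count_linext r (A :\ y :\ z)
    <= count_linext r (A :\ y))%N.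
  rewrite (setD1C A x y); apply: split_le => //; first by rewrite /M !inE eqxx andbF.
  by move=> z /MP[zx zy zm]; apply: minimals_setD1.
have eA : count_linext r A = (count_linext r (A :\ x) + (count_linext r (A :\ y)
    + \sum_(z in M) count_linext r (A :\ z)))%N.
  rewrite count_linext_min ?(neq0 A x) // (big_setD1 x) //= (big_setD1 y) //.
  by rewrite in_setD1 yx.
have key : (\sum_(z in M) count_linext r (A :\ z) * count_linext r (A :\ x :\ y)
   <= \sum_(z in M) (count_linext r (A :\ x) * count_linext r (A :\ y :\ z)
       + count_linext r (A :\ y) * count_linext r (A :\ x :\ z)))%N.
  apply: leq_sum => z /MP[zx zy zm]; have zA := maximals_sub zm.
  have xz : x != z by rewrite eq_sym.
  have yz : y != z by rewrite eq_sym.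
  have Az : (#|A :\ z| <= k)%N.
    by rewrite card_setD1 // -ltnS (leq_trans _ Ak) // ltn_predL card_gt0 (neq0 A z).
  have h1 := IH (A :\ z) Az (minimals_setD1 xm xz) (minimals_setD1 ym yz) xy.
  have h2 := count_linext_supermodular so ymx (minimals_setD1 zm zx) yz.
  have h3 := count_linext_supermodular so xmy (minimals_setD1 zm zy) xz.
  have c0 := count_linext_gt0 (A :\ x :\ y :\ z) so.
  move: h1 h2 h3 c0.
  rewrite (setD1C A z x) (setD1C A z y) (setD1C (A :\ x) z y) (setD1C A y x).
  set D := count_linext r (A :\ z); set C := count_linext r (A :\ x :\ y).
  set A' := count_linext r (A :\ x); set B := count_linext r (A :\ y).
  set a := count_linext r (A :\ x :\ z); set b := count_linext r (A :\ y :\ z).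
  set c := count_linext r (A :\ x :\ y :\ z).
  (* C D c <= 2 C a b = b (C a) + a (C b) <= (A' b + B a) c, by [h1], then [h2] and [h3]. *)
  move=> h1 h2 h3 c0; rewrite -(leq_pmul2r c0).
  have {}h1 := leq_mul (leqnn C) h1.
  have {}h2 := leq_mul (leqnn b) h2.
  have {}h3 := leq_mul (leqnn a) h3.
  move: D C A' B a b c h1 h2 h3 {c0} => D C A' B a b c; clear; lia.
rewrite -big_distrl big_split /= -!big_distrr /= in key.
have {}hA := leq_mul (leqnn (count_linext r (A :\ y))) hA.
have {}hB := leq_mul (leqnn (count_linext r (A :\ x))) hB.
rewrite eA; move: hA hB key; clear; lia.
Qed.
End Counting.

(** * Invariance of the count under embeddings *)

Lemma imset_setD1 (Q T : finType) (h : Q -> T) (B : {set Q}) z : injective h ->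
  h @: (B :\ z) = h @: B :\ h z.
Proof.
move=> hI; apply/setP=> t; rewrite in_setD1; apply/imsetP/andP.
  case=> u; rewrite in_setD1 => /andP[uz uB] ->.
  by rewrite (inj_eq hI) uz imset_f.
by case=> tz /imsetP[u uB tE]; exists u; rewrite // in_setD1 uB -(inj_eq hI) -tE tz.
Qed.

(** Used with [h = val] to count a subposet as a subset of the ambient poset. *)
Lemma count_linext_imset (Q T : finType) (h : Q -> T) (q : rel Q) (r : rel T)
    (B : {set Q}) : injective h -> (forall u v, q u v = r (h u) (h v)) ->
  count_linext q B = count_linext r (h @: B).
Proof.
move=> hI qr; move: {2}#|B| (leqnn #|B|) => k; elim: k B => [|k IH] B Bk.
  by move: Bk; rewrite leqn0 cards_eq0 => /eqP->; rewrite imset0 !count_linext0.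
have [->|B0] := eqVneq B set0; first by rewrite imset0 !count_linext0.
have maxE : maximals r (h @: B) = h @: maximals q B.
  apply/setP=> t; apply/maximalsP/imsetP.
    case=> /imsetP[u uB ->] um; exists u => //; apply/maximalsP; split=> // w wB.
    by rewrite qr um ?imset_f.
  case=> u /maximalsP[uB um] ->; split; first exact: imset_f.
  by move=> _ /imsetP[w wB ->]; rewrite -qr um.
rewrite !count_linext_max ?imset_eq0 // maxE big_imset /=; last by move=> ? ? _ _ /hI.
apply: eq_bigr => z /maximals_sub zB; rewrite IH ?imset_setD1 //.
by rewrite card_setD1 //; lia.
Qed.

(** * The recursive count equals the number of linear extensions as functions *)

Section Placements.
Variables (T : finType) (r : rel T) (m : nat) (x0 : 'I_m).
Implicit Types (A : {set T}) (f : {ffun T -> 'I_m}).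

(* Linear extensions of [A], extended to [T] by the junk value [x0]. *)
Definition placements A : {set {ffun T -> 'I_m}} :=
  [set f : {ffun T -> 'I_m} |
   [&& [forall u in A, f u < #|A|], [forall u in ~: A, f u == x0],
       [forall u in A, forall v in A, (f u == f v) ==> (u == v)]
     & [forall u in A, forall v in A, r u v ==> (f u < f v)]]].

Lemma placementsP A f :
  reflect [/\ {in A, forall u, f u < #|A|}, {in ~: A, forall u, f u = x0},
              {in A &, injective f} & {in A &, forall u v, r u v -> f u < f v}]
          (f \in placements A).
Proof.
rewrite inE; apply: (iffP and4P) => -[lt off inj mono]; split.
- exact/forall_inP.
- by move=> u uA; apply/eqP; move/forall_inP: off; apply.
- move=> u v uA vA fuv; apply/eqP; move/forall_inP/(_ u uA)/forall_inP/(_ v vA): inj.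
  by rewrite fuv eqxx.
- by move=> u v uA vA; move/forall_inP/(_ u uA)/forall_inP/(_ v vA)/implyP: mono.
- exact/forall_inP.
- by apply/forall_inP=> u uA; apply/eqP/off.
- apply/forall_inP=> u uA; apply/forall_inP=> v vA; apply/implyP=> /eqP fuv.
  exact/eqP/inj.
- by apply/forall_inP=> u uA; apply/forall_inP=> v vA; apply/implyP/mono.
Qed.

(** By pigeonhole, [f] takes all values 0, ..., k on [A]; an element above the one with value [k]
    would need a larger value. *)
Lemma placements_top A k f : #|A| = k.+1 -> f \in placements A ->
  exists2 z, z \in maximals r A & f z = k :> nat.
Proof.
move=> kA /placementsP[lt off inj mono].
have uqf : uniq [seq (f u : nat) | u <- enum A].
  rewrite map_inj_in_uniq ?enum_uniq //.
  by move=> u v; rewrite !mem_enum => uA vA /val_inj; apply: inj.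
have subf : {subset [seq (f u : nat) | u <- enum A] <= iota 0 k.+1}.
  move=> i /mapP[u]; rewrite mem_enum => uA ->.
  by rewrite mem_iota add0n -kA lt.
have [|_ eqf] := uniq_min_size uqf subf; first by rewrite size_iota size_map -cardE kA.
have : k \in iota 0 k.+1 by rewrite mem_iota ltnSn.
rewrite -eqf => /mapP[z]; rewrite mem_enum => zA fz; exists z; last by rewrite -fz.
apply/maximalsP; split=> // w wA; apply/negP=> /mono-/(_ zA wA).
by rewrite -fz ltnNge -ltnS -kA lt.
Qed.

(** The bijection [upd kO] puts [z] on top of a placement of [A :\ z]; its inverse resets [z] to the
    default [x0]. *)
Lemma card_placements_top A k (kO : 'I_m) z :
  #|A| = k.+1 -> kO = k :> nat -> z \in maximals r A ->
  #|[set f in placements A | f z == kO]| = #|placements (A :\ z)|.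
Proof.
move=> kA kOE /maximalsP[zA zm].
have kAz : #|A :\ z| = k by rewrite card_setD1 // kA.
pose upd (c : 'I_m) f : {ffun T -> 'I_m} := [ffun u => if u == z then c else f u].
rewrite -[RHS](@card_in_imset _ _ (upd kO)); last first.
  move=> f g /placementsP[_ offf _ _] /placementsP[_ offg _ _] fg.
  apply/ffunP=> u; have [->|uz] := eqVneq u z.
    by rewrite offf ?offg // !inE eqxx.
  by move/ffunP/(_ u): fg; rewrite !ffunE (negPf uz).
apply: eq_card => f; rewrite inE; apply/andP/imsetP.
  case=> /placementsP[lt off inj mono] /eqP fz; exists (upd x0 f); last first.
    by apply/ffunP=> u; rewrite !ffunE; case: eqVneq => [->|].
  apply/placementsP; split.
  - move=> u; rewrite in_setD1 => /andP[uz uA]; rewrite ffunE (negPf uz) kAz.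
    rewrite ltn_neqAle -ltnS -kA lt // andbT -kOE.
    by apply: contra_neq uz => /val_inj; rewrite -fz; apply: inj.
  - move=> u; rewrite !inE negb_and negbK ffunE; case: eqVneq => //= _ uA.
    by apply: off; rewrite inE.
  - move=> u v; rewrite !in_setD1 !ffunE => /andP[/negPf-> uA] /andP[/negPf-> vA].
    exact: inj.
  - move=> u v; rewrite !in_setD1 !ffunE => /andP[/negPf-> uA] /andP[/negPf-> vA].
    exact: mono.
case=> g /placementsP[lt off inj mono] ->; split; last by rewrite ffunE eqxx.
have ltk u : u \in A -> u != z -> g u < k.
  by move=> uA uz; rewrite -kAz lt // in_setD1 uz.
apply/placementsP; split.
- move=> u uA; rewrite ffunE kA; case: eqVneq => [_|uz]; first by rewrite kOE.
  by rewrite ltnW // ltnS ltk.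
- move=> u; rewrite inE ffunE => uA; case: eqVneq => [uz|_].
    by rewrite uz zA in uA.
  by apply: off; rewrite !inE negb_and uA orbT.
- move=> u v uA vA; rewrite !ffunE.
  case: (eqVneq u z) => [->|uz]; case: (eqVneq v z) => [->|vz] //.
  + by move/(congr1 val) => /= E; have := ltk v vA vz; rewrite -E kOE ltnn.
  + by move/(congr1 val) => /= E; have := ltk u uA uz; rewrite E kOE ltnn.
  + by apply: inj; rewrite in_setD1 ?uz ?vz.
- move=> u v uA vA ruv; rewrite !ffunE.
  case: (eqVneq u z) => [uz|uz]; first by move: (zm v vA); rewrite -uz ruv.
  case: (eqVneq v z) => [_|vz]; first by rewrite kOE ltk.
  by apply: mono; rewrite ?in_setD1 ?uz ?vz.
Qed.

(** Sorting the placements by their unique top element reproduces the recursion of [count_linext];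
    the bound on |A| makes the top value [kO] an element of ['I_m]. *)
Lemma card_placements A : #|A| <= m -> #|placements A| = count_linext r A.
Proof.
move: {2 3}#|A| (erefl #|A|) => k; elim: k A => [|k IH] A kA km.
  move/eqP: kA; rewrite cards_eq0 => /eqP->; rewrite count_linext0.
  apply/eqP/cards1P; exists [ffun=> x0]; apply/setP=> f; rewrite inE.
  apply/placementsP/eqP=> [[_ off _ _]|->].
    by apply/ffunP=> u; rewrite ffunE off // !inE.
  by split=> [u|u _|u v|u v]; rewrite ?inE // ffunE.
rewrite count_linext_max; last by rewrite -card_gt0 kA.
pose kO := Ordinal km.
transitivity (\sum_(f in placements A) \sum_(z in maximals r A | f z == kO) 1).
  rewrite -sum1_card; apply: eq_bigr => f fA.
  have [z zm fz] := placements_top kA fA.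
  rewrite (big_pred1 z) // => w; apply/andP/eqP=> [[wm /eqP fw]|->]; last first.
    by split=> //; apply/eqP/val_inj.
  have [_ _ inj _] := placementsP _ _ fA.
  apply: inj; rewrite ?(maximals_sub zm) ?(maximals_sub wm) //.
  by apply: val_inj; rewrite /= fw fz.
rewrite (exchange_big_dep [in maximals r A]) /=; last by move=> f z _ /andP[].
apply: eq_bigr => z zm; rewrite -IH; last 2 first.
- by rewrite card_setD1 ?(maximals_sub zm) ?kA.
- exact: ltnW.
rewrite -(card_placements_top kA (erefl : kO = k :> nat) zm) -sum1_card.
by apply: eq_bigl => f; rewrite inE zm.
Qed.

End Placements.

(** * Transfer to posets, and the theorem *)

Lemma strict_order_lt (d : Order.disp_t) (P : finPOrderType d) :
  strict_order (fun u v : P => (u < v)%O).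
Proof. by split; [exact: ltxx | exact: lt_trans]. Qed.

(** A nonempty [P] supplies the default value [Ordinal P0]; on the full set the condition on it is
    vacuous, and injectivity gives bijectivity by cardinality. *)
Lemma num_linextE (d : Order.disp_t) (P : finPOrderType d) :
  0 < #|P| ->
  num_linext P = count_linext (fun u v : P => (u < v)%O) [set: P].
Proof.
move=> P0; rewrite -(card_placements _ (Ordinal P0)) ?cardsT //.
apply: eq_card => f; rewrite inE; apply/linear_extensionP/placementsP.
  case=> fbij mono; split=> [u _|u|u v _ _|u v _ _]; first by rewrite cardsT.
  - by rewrite !inE.
  - exact: bij_inj.
  - exact: mono.
case=> _ _ inj mono; split; last by move=> u v; apply: mono; rewrite inE.
by apply: inj_card_bij => [u v|]; [apply: inj; rewrite inE | rewrite card_ord].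
Qed.

Lemma num_linext_subposet (d : Order.disp_t) (P : finPOrderType d)
    (A : {set P}) : A != set0 ->
  num_linext (subposet A) = count_linext (fun u v : P => (u < v)%O) A.
Proof.
move=> A0; rewrite num_linextE; last by rewrite card_sig card_gt0.
rewrite (@count_linext_imset _ P val _ (fun u v : P => (u < v)%O)); last 2 first.
- exact: val_inj.
- by move=> u v; rewrite lt_subposet.
congr count_linext; apply/setP=> u; apply/imsetP/idP=> [[v _ ->]|uA]; first exact: valP.
by exists (Sub u uA : subposet A).
Qed.

Lemma min_elemsE (d : Order.disp_t) (P : finPOrderType d) :
  min_elems P = minimals (fun u v : P => (u < v)%O) [set: P].
Proof.
apply/setP=> u; rewrite inE; apply/existsPn/minimalsP=> [um|[_ um] v].
  by split=> // w _; apply: um.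
exact/um.
Qed.

Local Open Scope ring_scope.

Theorem theorem1p1 (d : Order.disp_t) (P : finPOrderType d) (x y : P) :
  (2 < #|P|)%N -> x \in min_elems P -> y \in min_elems P -> x != y ->
  let n : rat := #|P|%:R in
  let ratio : rat :=
    ((num_linext P)%:R * (num_linext (subposet (~: [set x; y])))%:R) /
    ((num_linext (subposet (~: [set x])))%:R *
     (num_linext (subposet (~: [set y])))%:R) in
  n / (n - 1) <= ratio /\ ratio <= 2.
Proof.
move=> n_gt2; rewrite min_elemsE => xm ym xy /=.
have so := strict_order_lt P.
have DxE : ~: [set x] = [set: P] :\ x by rewrite -setTD.
have DyE : ~: [set y] = [set: P] :\ y by rewrite -setTD.
have DxyE : ~: [set x; y] = [set: P] :\ x :\ y by rewrite -setTD setDDl.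
have yTx : y \in [set: P] :\ x by rewrite !inE eq_sym xy.
(* More than two elements leave all three subposets nonempty, as [num_linext_subposet] requires. *)
have Dxy0 : [set: P] :\ x :\ y != set0.
  by rewrite -card_gt0 (card_setD1 yTx) (card_setD1 (in_setT x)) cardsT; case: #|_| n_gt2 => [|[|[|]]].
have neq0 z : [set: P] :\ z != set0.
  by rewrite -card_gt0 (card_setD1 (in_setT z)) cardsT; case: #|_| n_gt2 => [|[|[|]]].
rewrite DxE DyE DxyE !num_linext_subposet // num_linextE ?(ltn_trans _ n_gt2) //.
have lower := count_linext_lower so xm ym xy.
have upper := count_linext_upper so xm ym xy.
have A0 := count_linext_gt0 ([set: P] :\ x) so.
have B0 := count_linext_gt0 ([set: P] :\ y) so.
rewrite cardsT in lower.
have n1E : #|P|%:R - 1 = #|P|.-1%:R :> rat.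
  by rewrite -[in LHS](ltn_predK n_gt2) -natr1 addrK.
have n1_gt0 : 0 < #|P|.-1%:R :> rat by rewrite ltr0n -ltnS (ltn_predK n_gt2) ltnW.
have AB0 : 0 < (count_linext (fun u v : P => (u < v)%O) ([set: P] :\ x))%:R *
    (count_linext (fun u v : P => (u < v)%O) ([set: P] :\ y))%:R :> rat.
  by rewrite mulr_gt0 ?ltr0n.
split; last by rewrite ler_pdivrMr // -!natrM ler_nat.
rewrite n1E ler_pdivrMr // mulrAC ler_pdivlMr // -!natrM ler_nat.
by rewrite [leqRHS]mulnC.
Qed.
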